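(* Let $n\ge1$. For every lattice path $\pi\in\mathcal L_{n,n}$ we have $\operatorname{sw}(\pi)=\zeta_C(\pi)$. In particular the sweep map $\operatorname{sw}:\mathcal L_{n,n}\to\mathcal B_{2n}$ is a bijection.
   Context: $\mathcal L_{n,n}$: words in $\{N,E\}$ with $n$ letters of each kind; $\mathcal B_{2n}$: words of length $2n$ all of whose prefixes have at least as many $N$'s as $E$'s. For an integer vector $a=(a_1,\dots,a_n)$ and $j\ge0$: $\overrightarrow{S}^+_j(a)$ reads $a$ left to right writing $N$ for entries equal to $j$ and $E$ for entries equal to $j+1$; $\overleftarrow{S}^+_j(a)$ reads right to left; $\overrightarrow{S}^-_j(a),\overleftarrow{S}^-_j(a)$ likewise with $N$ for entries $-j$ and $E$ for entries $-j-1$. For $\pi\in\mathcal L_{n,n}$ let $\lambda_i$ be the number of East steps before the $i$-th North step, $\mu_i=(n+1-i)-\lambda_{n+1-i}$, and $\zeta_C(\pi)=\overleftarrow{S}^-_n(\mu)\overrightarrow{S}^+_n(\mu)\cdots\overleftarrow{S}^-_0(\mu)\overrightarrow{S}^+_0(\mu)$. Sweep map: write $\pi=s_1s_2\cdots s_{2n}$, $s_i\in\{N,E\}$. Set $\ell_1=0$ and $\ell_{i+1}=\ell_i+2n+1$ if $s_i=N$, $\ell_{i+1}=\ell_i-2n$ if $s_i=E$. Form a collection $X$ of $2n$ labelled steps: for each $i$ with $\ell_i<0$ add $(s_i,\ell_i)$; for each $i$ with $\ell_i>0$ add $(s_{i-1},-\ell_i)$; for $i=1$ (the step labelled $0$)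 add $(s_{2n},-n)$. Then $\operatorname{sw}(\pi)$ is the word obtained by repeatedly choosing the element $(s,\ell)\in X$ with minimal label $\ell$, writing down $s$, and removing $(s,\ell)$ from $X$, until $X$ is empty. *)

(* Defs.v *)
From HB Require Import structures.
From mathcomp Require Import all_boot all_order all_algebra.
From mathcomp Require Import classical_sets functions.

Set Implicit Arguments.
Unset Strict Implicit.
Unset Printing Implicit Defensive.

Import Order.TTheory GRing.Theory Num.Theory.
Local Open Scope ring_scope.

Inductive step := North | East.

Definition is_North (s : step) : bool := if s is North then true else false.
Definition step_of_bool (b : bool) : step := if b then North else East.

Lemma is_NorthK : cancel is_North step_of_bool.
Proof. by case. Qed.

HB.instance Definition _ := Equality.copy step (can_type is_NorthK).

Definition word := seq step.

Definition lattice_paths (n : nat) : set word :=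
  [set w | count_mem North w = n /\ count_mem East w = n].

Definition ballot_paths (m : nat) : set word :=
  [set w | size w = m /\
    forall p : word, prefix p w -> (count_mem East p <= count_mem North p)%N].

(* Indices are 1-based, as in s_1 s_2 ... s_{2n}; the default value of [nth]
   is never reached for 1 <= i <= size w. *)
Definition letter (w : word) (i : nat) : step := nth North w i.-1.

Definition read_entries (vN vE : int) (a : seq int) : word :=
  [seq if x == vN then North else East | x <- a & (x == vN) || (x == vE)].

Definition Splus_right (j : nat) (a : seq int) : word :=
  read_entries j%:Z (j%:Z + 1) a.

Definition Sminus_left (j : nat) (a : seq int) : word :=
  read_entries (- j%:Z) (- j%:Z - 1) (rev a).

(* 1-based positions. *)
Definition North_positions (w : word) : seq nat :=
  [seq k <- iota 1 (size w) | letter w k == North].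

Definition lambda (w : word) (i : nat) : nat :=
  count_mem East (take (nth 0%N (North_positions w) i.-1).-1 w).

Definition mu (n : nat) (w : word) : seq int :=
  [seq (n + 1 - i)%N%:Z - (lambda w (n + 1 - i))%:Z | i <- iota 1 n].

Definition zeta_C (n : nat) (w : word) : word :=
  flatten [seq Sminus_left j (mu n w) ++ Splus_right j (mu n w)
          | j <- rev (iota 0 n.+1)].

(* [sweep_label n w i] is the label of the i-th step for i >= 1; the value at
   i = 0 is junk. *)
Fixpoint sweep_label (n : nat) (w : word) (i : nat) : int :=
  match i with
  | 0 | 1 => 0
  | (_.+1 as k).+1 =>
      sweep_label n w k +
        (if letter w k == North then (2 * n + 1)%N%:Z else - (2 * n)%N%:Z)
  end.

Definition sweep_steps (n : nat) (w : word) : seq (step * int) :=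
  [seq (letter w i, sweep_label n w i)
    | i <- iota 1 (2 * n) & sweep_label n w i < 0] ++
  [seq (letter w i.-1, - sweep_label n w i)
    | i <- iota 1 (2 * n) & 0 < sweep_label n w i] ++
  [:: (letter w (2 * n), - n%:Z)].

(* For w in lattice_paths n with n >= 1 the labels in [sweep_steps n w] are
   pairwise distinct, so sorting by label is the same as repeatedly extracting
   the step of minimal label. *)
Definition sw (n : nat) (w : word) : word :=
  [seq x.1 | x <- sort (fun x y => x.2 <= y.2) (sweep_steps n w)].

(* Main.v *)
Require Import Defs.
From mathcomp Require Import all_boot all_order all_algebra.
From mathcomp Require Import classical_sets functions.
From mathcomp Require Import zify.

(* The label of a lattice point with k North and e East steps before it is
   2n(k - e) + k, so the sweep map sorts by height k - e and then by k.  It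
   lists, for decreasing j, the steps departing from height -(j+1) from left to
   right and then the steps arriving at height j from right to left.  Matching
   the first and last steps of the excursions below (above) these levels turns
   the two lists into the words S^-_j(mu) and S^+_j(mu), where mu, reversed, is
   the sequence h of heights reached by the North steps.

   Injectivity: counting letters, the final surplus of the word is twice the
   number of zeros of h; each block except S^+_0 is empty or ends in North, and
   its number of Norths is known from the blocks to its right, so the blocks
   can be parsed from the right.  They give the subsequences of h with values
   in {c, c+1} for all c, and these determine h because h increases by at most
   one at each step.

   Surjectivity: among the words of length m, those that stay nonnegative from
   height d are as many as those of surplus between -d and d+1, by induction
   on m; for d = 0 and m = 2n the latter are the words of surplus 0. *)

Set Implicit Arguments.
Unset Strict Implicit.
Unset Printing Implicit Defensive.

Import Order.TTheory GRing.Theory Num.Theory.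
Local Open Scope ring_scope.

(** * Heights reached by the North steps, and their values on pairs of levels *)

Definition upstep (a b : int) : bool := b <= a + 1.

Definition pair_filter (c : int) (s : seq int) : seq int :=
  [seq x <- s | (x == c) || (x == c + 1)].

Fixpoint heights (d : int) (w : word) : seq int :=
  match w with
  | [::] => [::]
  | North :: v => d + 1 :: heights (d + 1) v
  | East :: v => heights (d - 1) v
  end.

Definition surplus (w : word) : int :=
  (count_mem North w)%:Z - (count_mem East w)%:Z.

Lemma surplus_cat u v : surplus (u ++ v) = surplus u + surplus v.
Proof. rewrite /surplus !count_cat; lia. Qed.

Lemma surplus_cons s w :
  surplus (s :: w) = (if s is North then 1 else -1) + surplus w.
Proof. rewrite /surplus; case: s => /=; lia. Qed.

Lemma size_word (w : word) : size w = (count_mem North w + count_mem East w)%N.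
Proof. by elim: w => //= -[] w -> /=; lia. Qed.

Lemma size_heights d w : size (heights d w) = count_mem North w.
Proof. by elim: w d => //= -[] w IH d /=; rewrite IH. Qed.

Lemma upstep_weaken d d' s : d <= d' -> path upstep d s -> path upstep d' s.
Proof.
by case: s => //= x s ledd' /andP[xd ->]; rewrite andbT /upstep in xd *; lia.
Qed.

Lemma heights_path d w : path upstep d (heights d w).
Proof.
elim: w d => //= -[] w IH d /=; first by rewrite IH /upstep lexx.
by apply: upstep_weaken (IH (d - 1)); lia.
Qed.

Lemma last_heights d w : d + surplus w <= last d (heights d w).
Proof.
elim: w d => [|s w IH] d; first by rewrite addr0.
rewrite surplus_cons; case: s => /=; first by rewrite addrA; apply: IH.
have := IH (d - 1); case: (heights _ _) => [|y t] /=; lia.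
Qed.

Lemma heights_bounded d w x : x \in heights d w ->
  d - (count_mem East w)%:Z < x <= d + (count_mem North w)%:Z.
Proof.
elim: w d => //= -[] w IH d /=; last by move/IH; lia.
by rewrite in_cons => /orP[/eqP|/IH]; lia.
Qed.

(** After an initial East step the first height is at most [d], so the first height reveals the
    first letter; the length fixes the trailing East steps. *)
Lemma heights_inj d w w' :
  heights d w = heights d w' -> size w = size w' -> w = w'.
Proof.
elim: w w' d => [|s w IH] [|s' w'] d //= eqh [eqs].
case: s s' eqh => -[] //= eqh; last by rewrite (IH _ _ eqh).
- by case: eqh => /IH->.
- have := heights_path (d - 1) w'; rewrite -eqh /= /upstep; lia.
- have := heights_path (d - 1) w; rewrite eqh /= /upstep; lia.
Qed.

(** A climb from below [c] meets [c] before [c + 1]; the default [c] covers the empty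
    subsequence. *)
Lemma head_pair_filter d c s :
  path upstep d s -> d < c -> head c (pair_filter c s) = c.
Proof.
elim: s d => //= x s IH d /andP[xd pxs] dc; rewrite /upstep in xd.
have [xc|xc] := eqVneq x c; first by [].
rewrite (_ : (x == c + 1) = false); last by lia.
by apply: (IH x) => //; lia.
Qed.

(** To end above [c], the sequence must visit [c + 1] after its last visit to [c]. From a start at
    most [c], the default [c] makes the claim force a nonempty subsequence; from a higher start it
    may be empty. *)
Lemma last_pair_filter d c s :
  path upstep d s -> c < last d s ->
  last (if d <= c then c else c + 1) (pair_filter c s) = c + 1.
Proof.
elim: s d => [|x s IH] d /=; first by case: ifP => //; lia.
move=> /andP[xd pxs] cl; rewrite /upstep in xd.
have {IH} := IH x pxs cl.
have [->|xc] := eqVneq x c; first by rewrite lexx.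
have [->|xc1] /= := eqVneq x (c + 1); first by rewrite (_ : (c + 1 <= c) = false) //; lia.
case: (pair_filter c s) => //=; repeat case: ifP; lia.
Qed.

Lemma pair_filter_inj d d' s s' :
  path upstep d s -> path upstep d' s' ->
  (forall c, pair_filter c s = pair_filter c s') -> s = s'.
Proof.
have sub x y t t' : path upstep x t -> path upstep y t' -> x < y ->
    (forall c, pair_filter c (x :: t) = pair_filter c (y :: t')) -> False.
  move=> px py ltxy eqp.
  (* At level [y - 1] the second subsequence starts with [y], while the first, coming from below
     [y], is empty or starts with [y - 1]. *)
  have := eqp (y - 1); rewrite /= subrK eqxx orbT.
  have [|ne] := eqVneq x (y - 1); first by move=> ? []; lia.
  have -> : (x == y) = false by lia.
  have := @head_pair_filter _ (y - 1) _ px; rewrite /pair_filter subrK => hd /=.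
  by move=> e; move: hd; rewrite e /=; lia.
elim: s s' d d' => [|x t IH] [|y t'] d d' //.
- by move=> _ _ /(_ y) /=; rewrite eqxx.
- by move=> _ _ /(_ x) /=; rewrite eqxx.
move=> /= /andP[_ px] /andP[_ py] eqp.
have [eqxy|] := eqVneq x y; last first.
  rewrite neq_lt => /orP[lt|lt]; first by case: (sub _ _ _ _ px py lt eqp).
  by case: (sub _ _ _ _ py px lt (fun c => esym (eqp c))).
rewrite -eqxy in py eqp *; congr (_ :: _); apply: IH px py _ => c.
by have := eqp c; rewrite /pair_filter /=; case: ifP => // _ [].
Qed.

(* Blocks are parsed from the right: [v] is the longest suffix of [u ++ v]
   with its number of [North]s. *)
Lemma cat_inj_North (u u' v v' : word) :
  last North u = North -> last North u' = North ->
  count_mem North v = count_mem North v' ->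
  u ++ v = u' ++ v' -> u = u' /\ v = v'.
Proof.
wlog le : u u' v v' / (size v <= size v')%N => [hw lu lu' cv e|].
  have [/hw|/ltnW/hw] := leqP (size v) (size v'); first exact.
  by case/(_ u' u) => // -> ->.
move=> lu lu' cv e.
have su : (size u' <= size u)%N.
  by have := congr1 size e; rewrite !size_cat; lia.
have eu : u = u' ++ drop (size u') u.
  have := congr1 (take (size u')) e; rewrite takel_cat // take_size_cat // => {1}<-.
  by rewrite cat_take_drop.
move: (drop _ _) eu => t eu; rewrite eu -catA in e.
have /eqP := e; rewrite eqseq_cat // eqxx /= => /eqP ev.
move: cv; rewrite -ev count_cat => ct.
have {}ct : count_mem North t = 0%N by lia.
(* [t] has no North step, yet if nonempty it ends in the last letter of [u], which is North. *)
move: eu ev ct {e}; case/lastP: t => [|t s] eu ev ct; first by rewrite eu cats0.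
move: lu; rewrite eu last_cat last_rcons => es; move: ct; rewrite es -cats1 count_cat /=; lia.
Qed.

(** * The blocks of zeta as words in the heights, and their parsing *)

Section Zeta.
Variable h : seq int.

(** With [rev h] in the role of mu, the minus half reads [h] from left to right and the plus half
    from right to left. *)
Definition zeta_block (j : nat) : word :=
  Sminus_left j (rev h) ++ Splus_right j (rev h).
Definition zeta_blocks (m l : nat) : word :=
  flatten [seq zeta_block j | j <- rev (iota m l)].

Lemma zeta_blocksS m l :
  zeta_blocks m l.+1 = zeta_blocks m.+1 l ++ zeta_block m.
Proof. by rewrite /zeta_blocks /= rev_cons map_rcons flatten_rcons. Qed.

Lemma zeta_blocks0S l :
  zeta_blocks 0 l.+1 = zeta_block l ++ zeta_blocks 0 l.
Proof. by rewrite /zeta_blocks -addn1 iotaD rev_cat map_cat flatten_cat /= cats0. Qed.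

Lemma count_North_read vN vE (a : seq int) :
  count_mem North (read_entries vN vE a) = count_mem vN a.
Proof.
rewrite count_map count_filter; apply: eq_count => x /=.
by case: (x =P vN).
Qed.

Lemma count_East_read vN vE (a : seq int) : vN != vE ->
  count_mem East (read_entries vN vE a) = count_mem vE a.
Proof.
move=> ne; rewrite count_map count_filter; apply: eq_count => x /=.
by have [->|_] /= := eqVneq x vN; rewrite ?(negPf ne) ?andTb.
Qed.

Lemma count_North_minus j : count_mem North (Sminus_left j (rev h)) = count_mem (- j%:Z) h.
Proof. by rewrite count_North_read revK. Qed.

Lemma count_North_plus j : count_mem North (Splus_right j (rev h)) = count_mem j%:Z h.
Proof. by rewrite count_North_read count_rev. Qed.

Lemma count_East_minus j : count_mem East (Sminus_left j (rev h)) = count_mem (- j.+1%:Z) h.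
Proof.
rewrite count_East_read; last by lia.
by rewrite revK; congr (count (pred1 _) _); lia.
Qed.

Lemma count_East_plus j : count_mem East (Splus_right j (rev h)) = count_mem j.+1%:Z h.
Proof.
rewrite count_East_read; last by lia.
by rewrite count_rev; congr (count (pred1 _) _); lia.
Qed.

(** The North steps of block [j] count the entries [j] and [-j], its East steps those one level
    further out, so the sum telescopes; zeros count once in each half. *)
Lemma surplus_zeta_blocks l :
  surplus (zeta_blocks 0 l) = (2 * count_mem 0%:Z h)%N%:Z -
    (count_mem l%:Z h + count_mem (- l%:Z) h)%N%:Z.
Proof.
elim: l => [|l IH]; first by rewrite (_ : - 0%:Z = 0%:Z) // /surplus mul2n addnn subrr subrr.
rewrite zeta_blocks0S surplus_cat IH surplus_cat /surplus.
rewrite count_North_minus count_North_plus count_East_minus count_East_plus; lia.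
Qed.

(** A nonzero entry is written as North in one block and as East in the next lower one, a zero as
    North in both halves of block [0]. Entries of absolute value [l + 1] are written only once, as
    East. *)
Lemma size_zeta_blocks l :
  size (zeta_blocks 0 l.+1) =
  (count (fun x => (`|x| <= l.+1)%N) h + count (fun x => (`|x| <= l)%N) h)%N.
Proof.
have cnt m : count (fun x => (`|x| <= m.+1)%N) h =
   (count (fun x => (`|x| <= m)%N) h +
    (count_mem m.+1%:Z h + count_mem (- m.+1%:Z) h))%N.
  elim: h => //= x s IH; rewrite IH; lia.
have cnt0 : count (fun x => (`|x| <= 0)%N) h = count_mem 0%:Z h.
  by apply: eq_count => x /=; lia.
elim: l => [|l IH]; rewrite zeta_blocks0S size_cat.
  rewrite cnt cnt0 size_cat !size_word.
  rewrite count_North_minus count_North_plus count_East_minus count_East_plus.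
  rewrite (_ : - 0%:Z = 0%:Z) // !addn0.
  by move: (count_mem 0%:Z h) (count_mem 1%:Z h) (count_mem (- 1%:Z) h) => *; lia.
rewrite IH !cnt size_cat !size_word.
rewrite count_North_minus count_North_plus count_East_minus count_East_plus; lia.
Qed.

Hypothesis hpath : path upstep 0 h.
Hypothesis hlast : 0 <= last 0 h.

(** The heights end at or above [0], so any visit to [- j - 1] is followed by one to [- j], which is
    written as North. *)
Lemma last_Sminus j : last North (Sminus_left j (rev h)) = North.
Proof.
rewrite /Sminus_left revK /read_entries.
have := @last_pair_filter _ (- j%:Z - 1) _ hpath.
rewrite (_ : (0 <= _) = false); last by lia.
rewrite subrK => H.
have {}H : last (- j%:Z) (pair_filter (- j%:Z - 1) h) = - j%:Z.
  by apply: H; apply: lt_le_trans hlast; lia.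
rewrite (@eq_filter _ _ (fun x => (x == - j%:Z - 1) || (x == - j%:Z - 1 + 1))); last first.
  by move=> x /=; rewrite subrK orbC.
rewrite -/(pair_filter _ _).
case/lastP: (pair_filter _ _) H => //= s x.
by rewrite map_rcons !last_rcons => ->; rewrite eqxx.
Qed.

(** The first height among [j] and [j + 1] is [j]; reading from right to left puts it last. *)
Lemma last_Splus j : (0 < j)%N -> last North (Splus_right j (rev h)) = North.
Proof.
move=> j0; rewrite /Splus_right /read_entries filter_rev map_rev.
have := @head_pair_filter _ j%:Z _ hpath j0; rewrite /pair_filter.
case: [seq _ <- _ | _] => //= x s ->.
by rewrite rev_cons last_rcons eqxx.
Qed.

Lemma last_zeta_blocks m l : (0 < m)%N -> last North (zeta_blocks m l) = North.
Proof.
elim: l m => // l IH m m0; rewrite zeta_blocksS !last_cat IH // last_Sminus.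
by rewrite last_Splus.
Qed.

End Zeta.

(** The numbers of entries [m] and [-m] are the numbers of North steps in the two halves of block
    [m], so both halves split off from the right. Their East steps then count the entries [m + 1]
    and [- m - 1], as needed for the next block. *)
Lemma zeta_blocks_inj h h' m l : path upstep 0 h -> path upstep 0 h' ->
  0 <= last 0 h -> 0 <= last 0 h' ->
  count_mem m%:Z h = count_mem m%:Z h' ->
  count_mem (- m%:Z) h = count_mem (- m%:Z) h' ->
  zeta_blocks h m l = zeta_blocks h' m l ->
  forall j, (m <= j < m + l)%N -> Sminus_left j (rev h) = Sminus_left j (rev h')
    /\ Splus_right j (rev h) = Splus_right j (rev h').
Proof.
move=> ph ph' lh lh'; elim: l m => [|l IH] m cp cm; first by move=> _ j; lia.
rewrite !zeta_blocksS !catA => /cat_inj_North[].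
- by rewrite last_cat last_zeta_blocks // last_Sminus.
- by rewrite last_cat last_zeta_blocks // last_Sminus.
- by rewrite !count_North_plus.
move=> /cat_inj_North[].
- by rewrite last_zeta_blocks.
- by rewrite last_zeta_blocks.
- by rewrite !count_North_minus.
move=> eqz eqm eqp j jml.
have [->|jm] := eqVneq j m; first by [].
apply: (IH m.+1) => //; last by lia.
- by rewrite -count_East_plus eqp count_East_plus.
- by rewrite -count_East_minus eqm count_East_minus.
Qed.

Lemma read_entries_inj vN vE a a' :
  read_entries vN vE a = read_entries vN vE a' ->
  [seq x <- a | (x == vN) || (x == vE)] = [seq x <- a' | (x == vN) || (x == vE)].
Proof.
have readK b : [seq if s is North then vN else vE | s <- read_entries vN vE b]
    = [seq x <- b | (x == vN) || (x == vE)].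
  rewrite -map_comp -[RHS]map_id; apply/eq_in_map => x; rewrite mem_filter /=.
  by case: eqP => //= _ /andP[/eqP].
by move=> e; rewrite -readK e readK.
Qed.

Lemma zeta_blocks_determine n h h' : path upstep 0 h -> path upstep 0 h' ->
  0 <= last 0 h -> 0 <= last 0 h' ->
  (forall x, x \in h -> (`|x| <= n)%N) -> (forall x, x \in h' -> (`|x| <= n)%N) ->
  zeta_blocks h 0 n.+1 = zeta_blocks h' 0 n.+1 -> h = h'.
Proof.
move=> ph ph' lh lh' bh bh' eqz.
have out s c : (forall x, x \in s -> (`|x| <= n)%N) -> (n < `|c|)%N -> count_mem c s = 0%N.
  by move=> bs nc; apply/count_memPn/negP => /bs; lia.
(* No entry has absolute value [n + 1], so the surplus is exactly twice the number of zeros. *)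
have c0 : count_mem 0%:Z h = count_mem 0%:Z h'.
  have := congr1 surplus eqz; rewrite !surplus_zeta_blocks !(out _ n.+1%:Z) //.
  rewrite !(out _ (- n.+1%:Z)) //; lia.
have eqb := zeta_blocks_inj ph ph' lh lh' c0 c0 eqz.
apply: pair_filter_inj ph ph' _ => c.
have [cn|cn] := boolP (- n.+1%:Z <= c <= n%:Z); last first.
  have out' s : (forall x, x \in s -> (`|x| <= n)%N) -> pair_filter c s = [::].
    move=> bs; apply/eqP; rewrite -[_ == _]negbK -has_filter; apply/hasPn => x /bs.
    lia.
  by rewrite !out'.
case: (lerP 0 c) => c_ge0.
  have [|_] := eqb `|c|%N; first by lia.
  rewrite /Splus_right => /read_entries_inj; rewrite !filter_rev => /(can_inj revK).
  by rewrite /pair_filter gez0_abs.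
(* For negative [c], the levels [c + 1] and [c] are those read by the minus half of block
   [- c - 1]. *)
have [|+ _] := eqb `|(c + 1)%R|%N; first by lia.
rewrite /Sminus_left !revK => /read_entries_inj.
have -> : - `|(c + 1)%R|%N%:Z = c + 1 by lia.
by rewrite addrK /pair_filter => e; under eq_filter do rewrite orbC;
   rewrite e; under eq_filter do rewrite orbC.
Qed.

(** * Ballot paths *)

Fixpoint stays_nonneg (d : int) (w : word) : bool :=
  (0 <= d) &&
  match w with
  | [::] => true
  | North :: v => stays_nonneg (d + 1) v
  | East :: v => stays_nonneg (d - 1) v
  end.

Lemma stays_nonnegP d w :
  reflect (forall p, prefix p w -> 0 <= d + surplus p) (stays_nonneg d w).
Proof.
apply: (iffP idP) => [|H].
  elim: w d => [|s w IH] d /= /andP[d0].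
    by move=> _ [] // _; rewrite addr0.
  move=> Hs [|t p]; first by rewrite addr0.
  move=> /= /andP[/eqP-> pw]; rewrite surplus_cons.
  by rewrite addrA; case: s Hs => /IH; apply.
elim: w d H => [|s w IH] d H /=.
  by have := H [::] isT; rewrite addr0 => ->.
have := H [::] isT; rewrite addr0 => -> /=.
have {}H p : prefix p w -> 0 <= d + (if s is North then 1 else -1) + surplus p.
  by move=> pw; have := H (s :: p); rewrite surplus_cons addrA /= eqxx; apply.
by case: s H; apply: IH.
Qed.

Lemma stays_nonneg_cat d u v : (count_mem East u)%:Z <= d ->
  stays_nonneg (d + surplus u) v -> stays_nonneg d (u ++ v).
Proof.
elim: u d => [|s u IH] d /=; first by rewrite addr0.
rewrite surplus_cons addrA => du nv; apply/andP; split; first by lia.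
by case: s du nv => /= du nv; apply: IH nv; move: (count_mem _ u) du => *; lia.
Qed.

(** The height before a block is the number of its East steps, and its North steps provide the
    height needed before the next block. *)
Lemma zeta_blocks_nonneg h l :
  stays_nonneg (count_mem l%:Z h + count_mem (- l%:Z) h)%N%:Z (zeta_blocks h 0 l).
Proof.
elim: l => [|l IH] //; rewrite zeta_blocks0S -catA.
apply: stays_nonneg_cat; first by rewrite count_East_minus; lia.
apply: stays_nonneg_cat; rewrite /surplus ?count_East_plus;
  rewrite count_North_minus count_East_minus; first by lia.
rewrite count_North_plus; move: IH; congr (stays_nonneg _ _); lia.
Qed.

Fixpoint words (m : nat) : seq word :=
  if m is k.+1 then map (cons North) (words k) ++ map (cons East) (words k)
  else [:: [::]].

Lemma mem_words m (w : word) : (w \in words m) = (size w == m).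
Proof.
elim: m w => [|m IH] [|s w] //=; rewrite mem_cat.
  by apply/negbTE/norP; split; apply/mapP => -[].
rewrite eqSS -IH; apply/orP/idP => [[]/mapP[v ? [_ ->]] //|ww].
by case: s; [left | right]; apply: map_f.
Qed.

Lemma words_uniq m : uniq (words m).
Proof.
have cons_inj (s : step) : injective (cons s) by move=> ? ? [].
elim: m => //= m IH; rewrite cat_uniq !map_inj_uniq ?IH ?andbT //=.
by apply/hasPn => _ /mapP[v _ ->]; apply/mapP => -[].
Qed.

(** The induction is on the first letter. The value [-1] is allowed because an East step from [0]
    leads there; both counts then vanish. *)
Lemma count_stays_nonneg m (d : int) : -1 <= d ->
  count (stays_nonneg d) (words m) =
  count (fun w => - d <= surplus w <= d + 1) (words m).
Proof.
have shift (s : step) (a b : int) t : count (fun w => a <= surplus w <= b) (map (cons s) t)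
   = count (fun w => a - (if s is North then 1 else -1) <= surplus w
                     <= b - (if s is North then 1 else -1)) t.
  rewrite count_map; apply: eq_count => w /=; rewrite surplus_cons; case: s; lia.
elim: m d => [|m IH] d d1.
  by rewrite /= /surplus /=; lia.
have [->|d1'] := eqVneq d (-1).
  rewrite (eq_count (a2 := pred0)); last by case.
  rewrite [RHS](eq_count (a2 := pred0)) ?count_pred0 // => w /=; lia.
rewrite [words _]/= !count_cat !shift !count_map.
have d0 : 0 <= d by lia.
have -> : count (preim (cons North) (stays_nonneg d)) (words m)
    = count (stays_nonneg (d + 1)) (words m).
  by apply: eq_count => w /=; rewrite d0.
have -> : count (preim (cons East) (stays_nonneg d)) (words m)
    = count (stays_nonneg (d - 1)) (words m).
  by apply: eq_count => w /=; rewrite d0.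
rewrite !IH; [|lia|lia].
(* The intervals from [- d - 1] to [d + 2] and from [- d + 1] to [d] are the union and the
   intersection of those from [- d - 1] to [d] and from [- d + 1] to [d + 2]. *)
elim: (words m) => //= w t; lia.
Qed.

Definition paths n : seq word :=
  [seq w <- words (2 * n) | (count_mem North w == n) && (count_mem East w == n)].
Definition ballots m : seq word := [seq w <- words m | stays_nonneg 0 w].

Lemma mem_paths n w : reflect (lattice_paths n w) (w \in paths n).
Proof.
rewrite mem_filter mem_words size_word.
apply: (iffP idP) => [/andP[/andP[/eqP ? /eqP ?] _]|[-> ->]] //.
by rewrite !eqxx /=; lia.
Qed.

Lemma mem_ballots m w : reflect (ballot_paths m w) (w \in ballots m).
Proof.
rewrite mem_filter mem_words andbC.
apply: (iffP andP) => [[/eqP sw /stays_nonnegP H]|[sw H]]; split => //.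
- by move=> p /H; rewrite /surplus; lia.
- by rewrite sw.
- by apply/stays_nonnegP => p /H; rewrite /surplus; lia.
Qed.

(** A word of even length has even surplus, so a surplus in [{0, 1}] is [0]. *)
Lemma size_ballots n : size (ballots (2 * n)) = size (paths n).
Proof.
rewrite !size_filter count_stays_nonneg //; apply: eq_in_count => w.
by rewrite mem_words size_word /surplus => /eqP; lia.
Qed.

(** * The blocks of the sweep map *)

Lemma iotaS_map m n : iota m.+1 n = [seq i.+1 | i <- iota m n].
Proof. exact: iotaDl 1%N m n. Qed.

(** * The sequence mu as the reversed heights *)

Definition North_offsets (w : word) : seq nat :=
  [seq i <- iota 0 (size w) | nth North w i == North].

Lemma North_offsets_cons s w : North_offsets (s :: w) =
  (if s is North then [:: 0%N] else [::]) ++ [seq i.+1 | i <- North_offsets w].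
Proof. by rewrite /North_offsets /= iotaS_map filter_map; case: s. Qed.

Lemma size_North_offsets w : size (North_offsets w) = count_mem North w.
Proof.
elim: w => // s w IH; rewrite North_offsets_cons size_cat size_map IH.
by case: s.
Qed.

Lemma lambdaE (w : word) i : (i < count_mem North w)%N ->
  lambda w i.+1 = count_mem East (take (nth 0%N (North_offsets w) i) w).
Proof.
move=> iw; rewrite /lambda (_ : North_positions w = [seq i.+1 | i <- North_offsets w]).
  by rewrite (nth_map 0%N) // size_North_offsets.
by rewrite /North_positions iotaS_map filter_map.
Qed.

Lemma heightsE (d : int) (w : word) :
  heights d w = [seq d + i.+1%:Z - (lambda w i.+1)%:Z | i <- iota 0 (count_mem North w)].
Proof.
transitivity [seq d + i.+1%:Z - (count_mem East (take (nth 0%N (North_offsets w) i) w))%:Z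
    | i <- iota 0 (count_mem North w)]; last first.
  by apply/eq_in_map => i; rewrite mem_iota => /lambdaE->.
elim: w d => // s w IH d; rewrite North_offsets_cons.
case: s => /=.
  rewrite iotaS_map -map_comp subr0 IH; congr (_ :: _).
  apply/eq_in_map => i; rewrite mem_iota => iw /=.
  by rewrite (nth_map 0%N) ?size_North_offsets //=; lia.
rewrite IH; apply/eq_in_map => i; rewrite mem_iota => iw /=.
by rewrite (nth_map 0%N) ?size_North_offsets //=; lia.
Qed.

Lemma mu_heights n w : count_mem North w = n -> mu n w = rev (heights 0 w).
Proof.
move=> cN; rewrite heightsE cN /mu.
apply: (@eq_from_nth _ 0) => [|i]; first by rewrite size_rev !size_map !size_iota.
rewrite size_map size_iota => ltin.
rewrite nth_rev size_map size_iota // !(nth_map 0%N) ?size_iota //; last by lia.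
rewrite !nth_iota //; last by lia.
by rewrite (_ : n + 1 - (1 + i) = (0 + (n - i.+1)).+1)%N ?add0r; last by lia.
Qed.

Lemma zeta_C_blocks n w : count_mem North w = n ->
  zeta_C n w = zeta_blocks (heights 0 w) 0 n.+1.
Proof. by move=> cN; rewrite /zeta_C mu_heights. Qed.

(* A step together with one of its end points, given by the number of North
   and East steps before it. *)
Definition marked_step : Type := (step * (nat * nat))%type.

Fixpoint departures (k e : nat) (w : word) : seq marked_step :=
  match w with
  | [::] => [::]
  | North :: v => (North, (k, e)) :: departures k.+1 e v
  | East :: v => (East, (k, e)) :: departures k e.+1 v
  end.

Fixpoint arrivals (k e : nat) (w : word) : seq marked_step :=
  match w with
  | [::] => [::]
  | North :: v => (North, (k.+1, e)) :: arrivals k.+1 e v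
  | East :: v => (East, (k, e.+1)) :: arrivals k e.+1 v
  end.

Definition height (x : marked_step) : int := x.2.1%:Z - x.2.2%:Z.
Definition time (x : marked_step) : nat := (x.2.1 + x.2.2)%N.
Definition label (n : nat) (x : marked_step) : int :=
  (2 * n)%N%:Z * height x + x.2.1%:Z.

Lemma departuresE k e w : departures k e w =
  [seq (nth North w i, ((k + count_mem North (take i w))%N,
                        (e + count_mem East (take i w))%N)) | i <- iota 0 (size w)].
Proof.
elim: w k e => // s w IH k e /=; rewrite iotaS_map -map_comp !addn0.
case: s; rewrite IH; congr (_ :: _); apply: eq_map => i /=.
- by congr (_, (_, _)); lia.
- by congr (_, (_, _)); lia.
Qed.

Lemma arrivalsE k e w : arrivals k e w =
  [seq (nth North w i, ((k + count_mem North (take i.+1 w))%N,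
                        (e + count_mem East (take i.+1 w))%N)) | i <- iota 0 (size w)].
Proof.
elim: w k e => // s w IH k e /=; rewrite iotaS_map -map_comp take0.
case: s; rewrite IH; congr ((_, (_, _)) :: _) => /=; try lia; apply: eq_map => i /=.
- by congr (_, (_, _)); lia.
- by congr (_, (_, _)); lia.
Qed.

Lemma sweep_labelE n w i : (i <= size w)%N ->
  sweep_label n w i.+1 = (2 * n)%N%:Z * surplus (take i w) + (count_mem North (take i w))%:Z.
Proof.
elim: i => [|i IH] iw; first by rewrite take0 /surplus subrr mulr0.
rewrite [LHS]/= -/(sweep_label n w i.+1) IH; last by lia.
rewrite (take_nth North) // -cats1 surplus_cat /letter /= count_cat /surplus.
by case: (nth _ _ _) => /=; lia.
Qed.

(** The label of step [i] belongs to the point where that step departs and step [i - 1] arrives. The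
    extra step with label [-n] fits in, since the end point of the path has label [n]. *)
Lemma sweep_stepsE n w : (1 <= n)%N -> lattice_paths n w ->
  sweep_steps n w =
    [seq (x.1, label n x) | x <- departures 0 0 w & label n x < 0] ++
    [seq (x.1, - label n x) | x <- arrivals 0 0 w & 0 < label n x].
Proof.
move=> n0 [cN cE]; have sw : size w = (2 * n)%N by rewrite size_word cN cE; lia.
rewrite /sweep_steps departuresE arrivalsE sw !filter_map -!map_comp.
congr (_ ++ _).
  rewrite iotaS_map filter_map -map_comp.
  rewrite (eq_in_filter (a2 := preim (fun i => (nth North w i,
      ((0 + count_mem North (take i w))%N, (0 + count_mem East (take i w))%N)))
      (fun x => label n x < 0))).
    apply/eq_in_map => i; rewrite mem_filter mem_iota => /andP[_ iw].
    by rewrite /comp sweep_labelE ?sw //; lia.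
  move=> i; rewrite mem_iota => iw; rewrite /preim /=.
  by rewrite -/(sweep_label n w i.+1) sweep_labelE ?sw //; lia.
have lab_end : sweep_label n w (2 * n).+1 = n%:Z.
  by rewrite sweep_labelE -?sw // take_size /surplus cN cE; lia.
pose F i := (letter w i.-1, - sweep_label n w i).
have -> : [:: (letter w (2 * n), - n%:Z)] =
    [seq F i | i <- [:: (2 * n).+1] & 0 < sweep_label n w i].
  by rewrite [filter _ _]/= -/(sweep_label n w (2 * n).+1) lab_end
    (_ : 0 < n%:Z) //= /F lab_end.
rewrite -map_cat -filter_cat -[[:: _]]/(iota (1 + 2 * n) 1) -iotaD addn1.
(* Index [1] drops out, as its label [0] is not positive. *)
rewrite /= iotaS_map iotaS_map -map_comp filter_map -map_comp.
rewrite (eq_in_filter (a2 := preim (fun i => (nth North w i,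
      ((0 + count_mem North (take i.+1 w))%N, (0 + count_mem East (take i.+1 w))%N)))
      (fun x => 0 < label n x))).
  apply/eq_in_map => i; rewrite mem_filter mem_iota => /andP[_ iw].
  by rewrite /F /comp sweep_labelE ?sw //; lia.
move=> i; rewrite mem_iota => iw; rewrite /preim /=.
by rewrite -/(sweep_label n w i.+2) sweep_labelE ?sw //; lia.
Qed.

(** * Matching the two ends of excursions *)

Section Blocks.
Variable j : int.

(* Each excursion above height [j] begins with a North step arriving at
   [j + 1] and ends with an East step arriving at [j]. *)
Lemma arrivals_read k e w : k%:Z - e%:Z + surplus w <= j ->
  [seq x.1 | x <- arrivals k e w & height x == j] =
  (if k%:Z - e%:Z <= j then [::] else [:: East]) ++
  read_entries j (j + 1) (heights (k%:Z - e%:Z) w).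
Proof.
elim: w k e => [|s w IH] k e; first by rewrite /surplus /= addr0 => ->.
rewrite surplus_cons; case: s => /= endj.
  rewrite (fun_if (map _)) /= IH; last by lia.
  rewrite /read_entries /= /height /=.
  rewrite (_ : k.+1%:Z - e%:Z = k%:Z - e%:Z + 1); last by lia.
  move: (k%:Z - e%:Z) => d.
  have [<-|dj] := eqVneq (d + 1) j.
    rewrite lexx (_ : d <= d + 1) //=; last by lia.
    by rewrite eqxx.
  rewrite /= (inj_eq (addIr 1)).
  have [dE|dj'] := eqVneq d j.
    have -> : (d + 1 <= j) = false by lia.
    by rewrite dE in dj *; rewrite lexx /= (negPf dj).
  by rewrite (_ : (d + 1 <= j) = (d <= j)) //; lia.
rewrite (fun_if (map _)) /= IH; last by lia.
rewrite /height /= (_ : k%:Z - e.+1%:Z = k%:Z - e%:Z - 1); last by lia.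
move: (k%:Z - e%:Z) => d.
have [<-|dj] := eqVneq (d - 1) j.
  by rewrite lexx (_ : (d <= d - 1) = false) //; lia.
by rewrite (_ : (d - 1 <= j) = (d <= j)) //; lia.
Qed.

(** Each excursion below [j] begins with an East step departing from [j] and ends with a North step
    arriving at [j], with no letter of either word in between. A start below [j] leaves one such
    arrival unmatched, hence the extra East. *)
Lemma departures_read k e w : j < k%:Z - e%:Z + surplus w ->
  read_entries (j + 1) j (heights (k%:Z - e%:Z) w) =
  (if j <= k%:Z - e%:Z then [::] else [:: East]) ++
  [seq x.1 | x <- departures k e w & height x == j].
Proof.
elim: w k e => [|s w IH] k e; first by rewrite /surplus /= addr0 => /ltW ->.
rewrite surplus_cons; case: s => /= endj.
  rewrite (fun_if (map _)) /=.
  have := IH k.+1 e; rewrite (_ : k.+1%:Z - e%:Z = k%:Z - e%:Z + 1); last by lia.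
  rewrite /height /=; move: (k%:Z - e%:Z) endj => d endj.
  rewrite /read_entries /= (inj_eq (addIr 1)) => {}IH.
  have [dE|dj] := eqVneq d j.
    rewrite dE in IH endj *; rewrite lexx /= IH; last by lia.
    by rewrite (_ : j <= j + 1) ?eqxx //; lia.
  have [e1|dj'] := eqVneq (d + 1) j.
    rewrite /= IH; last by lia.
    have -> : (j <= d) = false by lia.
    by rewrite e1 lexx /= (_ : (j == j + 1) = false) //; lia.
  by rewrite /= IH; [rewrite (_ : (j <= d + 1) = (j <= d)) //; lia|lia].
rewrite (fun_if (map _)) /=.
have := IH k e.+1; rewrite (_ : k%:Z - e.+1%:Z = k%:Z - e%:Z - 1); last by lia.
rewrite /height /=; move: (k%:Z - e%:Z) endj => d endj.
move=> ->; last by lia.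
have [->|dj] := eqVneq d j.
  by rewrite lexx (_ : (j <= j - 1) = false) //; lia.
by rewrite (_ : (j <= d - 1) = (j <= d)) //; lia.
Qed.
End Blocks.

Lemma departures_bounds k e w (x : marked_step) : x \in departures k e w ->
  [&& (k <= x.2.1 <= k + count_mem North w)%N,
      (e <= x.2.2 <= e + count_mem East w)%N & (k + e <= time x)%N].
Proof.
elim: w k e => // s w IH k e; rewrite /time.
case: s => /=; rewrite in_cons => /orP[/eqP-> /=|/IH {IH}]; rewrite /time;
  by move: (count_mem North w) (count_mem East w); lia.
Qed.

Lemma arrivals_bounds k e w (x : marked_step) : x \in arrivals k e w ->
  [&& (k <= x.2.1 <= k + count_mem North w)%N,
      (e <= x.2.2 <= e + count_mem East w)%N & (k + e < time x)%N].
Proof.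
elim: w k e => // s w IH k e; rewrite /time.
case: s => /=; rewrite in_cons => /orP[/eqP-> /=|/IH {IH}]; rewrite /time;
  by move: (count_mem North w) (count_mem East w); lia.
Qed.

Lemma departures_time k e w :
  pairwise (fun x y => time x < time y)%N (departures k e w).
Proof.
elim: w k e => // s w IH k e.
by case: s => /=; rewrite IH andbT; apply/allP => x /departures_bounds;
  rewrite /time /=; lia.
Qed.

Lemma arrivals_time k e w :
  pairwise (fun x y => time x < time y)%N (arrivals k e w).
Proof.
elim: w k e => // s w IH k e.
by case: s => /=; rewrite IH andbT; apply/allP => x /arrivals_bounds;
  rewrite /time /=; lia.
Qed.

(** * Sorting by buckets of labels *)

Definition label_lt (x y : step * int) : bool := x.2 < y.2.

(** Strictly increasing labels are distinct, so comparison of labels is antisymmetric on the members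
    and the sorted list is unique. *)
Lemma sort_label_lt (X Y : seq (step * int)) :
  perm_eq Y X -> pairwise label_lt Y -> sort (fun x y => x.2 <= y.2) X = Y.
Proof.
move=> pYX pY.
have tr : transitive (fun x y : step * int => x.2 <= y.2).
  by move=> ? ? ?; apply: le_trans.
have pX : perm_eq (sort (fun x y => x.2 <= y.2) X) Y.
  by rewrite perm_sort perm_sym.
apply: (@sorted_eq_in _ (fun x y => x.2 <= y.2) _ _ _ _ _ _ pX).
- by move=> ? ? ? _ _ _; apply: tr.
- move=> x y; rewrite !(perm_mem pX) => xY yY /le_anti; elim: Y pY xY yY {pYX pX} => //.
  move=> z Y IH /andP[/allP ltz pY]; rewrite !inE.
  move=> /predU1P[->|xY] /predU1P[->|yY] // e; last exact: IH.
  + by have := ltz _ yY; rewrite /label_lt e ltxx.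
  + by have := ltz _ xY; rewrite /label_lt e ltxx.
- by apply: sort_sorted => x y; apply: le_total.
- by apply: pairwise_sorted; apply: sub_pairwise pY => x y /ltW.
Qed.

Section Buckets.
Variables (X : seq (step * int)) (block : nat -> seq (step * int)) (t : nat -> int).
Hypothesis t_decr : forall j, t j.+1 <= t j.
Hypothesis blockE : forall j, perm_eq (block j) [seq x <- X | t j.+1 <= x.2 < t j].
Hypothesis block_lt : forall j, pairwise label_lt (block j).

Let t_le0 j : t j <= t 0.
Proof. by elim: j => // j; apply: le_trans. Qed.

Lemma buckets_perm m :
  perm_eq (flatten [seq block j | j <- rev (iota 0 m)]) [seq x <- X | t m <= x.2 < t 0].
Proof.
elim: m => [|m IH].
  by rewrite (eq_filter (a2 := pred0)) ?filter_pred0 // => x /=; lia.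
rewrite -addn1 iotaD rev_cat map_cat flatten_cat /= cats0 addn1.
apply/permP => a; rewrite count_cat (permP IH) (permP (blockE m)) !count_filter.
rewrite -count_predUI [X in (_ + X)%N](eq_count (a2 := pred0)) ?count_pred0 ?addn0.
  by apply: eq_count => x /=; have := t_decr m; have := t_le0 m; case: (a x) => //=; lia.
by move=> x /=; case: (a x) => //=; lia.
Qed.

Lemma buckets_lt m : pairwise label_lt (flatten [seq block j | j <- rev (iota 0 m)]).
Proof.
elim: m => // m IH.
rewrite -addn1 iotaD rev_cat map_cat flatten_cat /= cats0.
rewrite pairwise_cat IH block_lt !andbT; apply/allrelP => x y.
rewrite (perm_mem (blockE m)) (perm_mem (buckets_perm m)) !mem_filter /label_lt.
by move=> /andP[/andP[_ xt] _] /andP[/andP[yt _] _]; apply: lt_le_trans yt.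
Qed.
End Buckets.

(** * The sweep map as a concatenation of blocks *)

Section SweepBlocks.
Variables (n : nat) (w : word).
Hypotheses (n0 : (1 <= n)%N) (wP : lattice_paths n w).

Definition below_block (j : nat) : seq (step * int) :=
  [seq (x.1, label n x) | x <- departures 0 0 w & height x == - j.+1%:Z].
Definition above_block (j : nat) : seq (step * int) :=
  rev [seq (x.1, - label n x) | x <- arrivals 0 0 w & height x == j%:Z].
Definition sweep_block j := below_block j ++ above_block j.
Definition threshold (j : nat) : int := - (2 * n * j)%N%:Z.

(** As [0 <= k <= n < 2n], the height is the quotient of the label by [2n]. *)
Lemma departure_label x j : x \in departures 0 0 w ->
  (threshold j.+1 <= label n x < threshold j) && (label n x < 0)
  = (height x == - j.+1%:Z).
Proof.
case: wP => cN cE /departures_bounds; rewrite cN cE /threshold /label.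
have : height x = x.2.1%:Z - x.2.2%:Z by [].
move: x.2.1 x.2.2 (height x) => k e d dE /and3P[kn en _].
apply/idP/idP => [lab|/eqP ->]; last by nia.
have [lt|gt|//] := ltgtP d (- j.+1%:Z); nia.
Qed.

(** An arrival at height at least [0] has [k >= 1], because [k + e > 0]; this keeps the label off
    the open end of the interval. *)
Lemma arrival_label x j : x \in arrivals 0 0 w ->
  (threshold j.+1 <= - label n x < threshold j) && (0 < label n x)
  = (height x == j%:Z).
Proof.
case: wP => cN cE /arrivals_bounds; rewrite cN cE /threshold /label /time.
have : height x = x.2.1%:Z - x.2.2%:Z by [].
move: x.2.1 x.2.2 (height x) => k e d dE /and3P[kn en t].
apply/idP/idP => [lab|/eqP dj]; last by rewrite dj; nia.
have [lt|gt|//] := ltgtP d j%:Z; nia.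
Qed.

Lemma sweep_blockE j : perm_eq (sweep_block j)
  [seq x <- sweep_steps n w | threshold j.+1 <= x.2 < threshold j].
Proof.
have perm_map_filter (f : marked_step -> step * int) (a b : pred marked_step) s :
    {in s, a =1 b} -> perm_eq [seq f x | x <- s & a x] [seq f x | x <- s & b x].
  by move/eq_in_filter->.
rewrite sweep_stepsE // filter_cat !filter_map -!filter_predI; apply: perm_cat.
  by apply: perm_map_filter => x xD /=; rewrite departure_label.
by rewrite perm_rev; apply: perm_map_filter => x xA /=; rewrite arrival_label.
Qed.

Lemma label_lt_trans : transitive label_lt.
Proof. by move=> ? ? ?; apply: lt_trans. Qed.

Lemma time_label_lt (c : int) (x y : marked_step) : height x = c -> height y = c ->
  (time x < time y)%N -> label n x < label n y.
Proof.
move=> hx hy; rewrite /label hx hy ltrD2l /time; move: hx hy; rewrite /height; lia.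
Qed.

Lemma sweep_block_lt j : pairwise label_lt (sweep_block j).
Proof.
have by_height (c : int) (s : seq marked_step) :
    pairwise (fun x y => time x < time y)%N s ->
    pairwise (fun x y => label n x < label n y) [seq x <- s | height x == c].
  move=> /(pairwise_filter (fun x => height x == c)).
  apply: (sub_in_pairwise (P := fun x => height x == c)); last exact: filter_all.
  by move=> x y /eqP + /eqP; apply: time_label_lt.
rewrite pairwise_cat; apply/and3P; split.
(* A departure from height [- (j + 1)] has [k <= n - 1] since [e <= n], and an arrival has
   [k' <= n]; thus [k + k' < 2n], which separates the halves. *)
- apply/allrelP => x y; rewrite mem_rev => /mapP[x' + ->] /mapP[y' + ->].
  rewrite !mem_filter => /andP[/eqP hx /departures_bounds bx].
  move=> /andP[/eqP hy /arrivals_bounds b_y].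
  case: wP bx b_y => -> -> /and3P[_ bx _] /and3P[b_y _ _].
  rewrite /label_lt /label hx hy /=; move: hx bx b_y; rewrite /height.
  move: x'.2.1 x'.2.2 y'.2.1 y'.2.2 => k e k' e'.
  by move=> *; nia.
- by rewrite pairwise_map; apply: by_height; apply: departures_time.
rewrite -(sorted_pairwise label_lt_trans) rev_sorted pairwise_sorted // pairwise_map.
apply: sub_pairwise (by_height _ _ (arrivals_time 0 0 w)) => x y /=.
by rewrite /label_lt /= ltrN2.
Qed.

Lemma sweep_block_letters j :
  [seq x.1 | x <- sweep_block j] = zeta_block (heights 0 w) j.
Proof.
have w0 : surplus w = 0 by case: wP => cN cE; rewrite /surplus cN cE subrr.
rewrite map_cat map_rev -!map_comp; congr (_ ++ _).
  have := @departures_read (- j%:Z - 1) 0 0 w.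
  rewrite w0 subrr subrK (_ : - j%:Z - 1 <= 0) /=; last by lia.
  rewrite /Sminus_left revK => ->; last by lia.
  by rewrite (_ : - j.+1%:Z = - j%:Z - 1) //; lia.
have := @arrivals_read j%:Z 0 0 w; rewrite w0 subrr => /(_ isT) /= ->.
by rewrite /Splus_right /read_entries filter_rev map_rev.
Qed.

Lemma sw_zeta_blocks : sw n w = zeta_blocks (heights 0 w) 0 n.+1.
Proof.
pose Y := flatten [seq sweep_block j | j <- rev (iota 0 n.+1)].
have tdecr j : threshold j.+1 <= threshold j by rewrite /threshold; lia.
have pY : perm_eq Y (sweep_steps n w).
  apply: perm_trans (buckets_perm tdecr sweep_blockE _) _.
  (* All labels are negative and at least [- (2n * n + n)], so blocks [0] to [n] exhaust the
     steps. *)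
  rewrite (@eq_in_filter _ _ predT) ?filter_predT // => x.
  case: wP => cN cE; rewrite sweep_stepsE // mem_cat.
  case/orP => /mapP[y + ->]; rewrite mem_filter => /andP[ly].
    move=> /departures_bounds; move: ly; rewrite cN cE /label /height /threshold /=; nia.
  move=> /arrivals_bounds; move: ly; rewrite cN cE /label /height /threshold /=; nia.
rewrite /sw (sort_label_lt pY (buckets_lt tdecr sweep_blockE sweep_block_lt _)).
rewrite map_flatten -map_comp; congr flatten; apply: eq_map => j.
exact: sweep_block_letters.
Qed.

End SweepBlocks.

(** * Equality with zeta and bijectivity *)

Lemma sw_zeta_C n w : (1 <= n)%N -> lattice_paths n w -> sw n w = zeta_C n w.
Proof. by move=> n0 wP; rewrite sw_zeta_blocks // zeta_C_blocks //; case: wP. Qed.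

Lemma lattice_heights_bounded n w x : lattice_paths n w -> x \in heights 0 w -> (`|x| <= n)%N.
Proof. by case=> cN cE /heights_bounded; rewrite cN cE; lia. Qed.

Lemma sw_ballot n w : (1 <= n)%N -> lattice_paths n w -> ballot_paths (2 * n) (sw n w).
Proof.
move=> n0 wP; rewrite sw_zeta_blocks //; apply/mem_ballots.
have bnd x : x \in heights 0 w -> (`|x| <= n)%N by apply: lattice_heights_bounded.
have c0 (c : int) : (n < `|c|)%N -> count_mem c (heights 0 w) = 0%N.
  by move=> nc; apply/count_memPn/negP => /bnd; lia.
have cnt m : (n <= m)%N -> count (fun x => (`|x| <= m)%N) (heights 0 w) = n.
  move=> nm; have <- : size (heights 0 w) = n by rewrite size_heights; case: wP.
  by apply/eqP; rewrite -all_count; apply/allP => x /bnd /leq_trans; apply.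
rewrite mem_filter mem_words size_zeta_blocks !cnt // mul2n addnn eqxx andbT.
(* No entry has absolute value [n + 1], so the starting height is [0]. *)
by have := zeta_blocks_nonneg (heights 0 w) n.+1; rewrite !c0.
Qed.

Lemma sw_inj n w w' : (1 <= n)%N -> lattice_paths n w -> lattice_paths n w' ->
  sw n w = sw n w' -> w = w'.
Proof.
move=> n0 wP wP'; rewrite !sw_zeta_blocks // => e.
have last0 v : lattice_paths n v -> 0 <= last 0 (heights 0 v).
  case=> cN cE; apply: le_trans (last_heights 0 v).
  by rewrite /surplus cN cE subrr addr0.
have eqh : heights 0 w = heights 0 w'.
  apply: zeta_blocks_determine e; rewrite ?heights_path ?last0 //.
  - by move=> x; apply: lattice_heights_bounded.
  - by move=> x; apply: lattice_heights_bounded.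
apply: heights_inj eqh _.
by case: wP => cN cE; case: wP' => cN' cE'; rewrite !size_word cN cN' cE cE'.
Qed.

Local Open Scope classical_set_scope.

Theorem theorem4p22 (n : nat) (hn : (1 <= n)%N) :
  (forall w : word, lattice_paths n w -> sw n w = zeta_C n w) /\
  set_bij (lattice_paths n) (ballot_paths (2 * n)) (sw n).
Proof.
split; first by move=> w; apply: sw_zeta_C.
split.
- by move=> w wP; apply: sw_ballot.
- by move=> w w' /set_mem wP /set_mem wP'; apply: sw_inj.
have uniq_sw : uniq (map (sw n) (paths n)).
  rewrite map_inj_in_uniq ?filter_uniq ?words_uniq //.
  by move=> w w' /mem_paths wP /mem_paths wP'; apply: sw_inj.
have sub_sw : {subset map (sw n) (paths n) <= ballots (2 * n)}.
  by move=> _ /mapP[w /mem_paths wP ->]; apply/mem_ballots; apply: sw_ballot.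
(* A duplicate-free list inside one of the same size has the same members, which gives
   surjectivity. *)
have [|_ eq_sw] := uniq_min_size uniq_sw sub_sw; first by rewrite size_map size_ballots.
move=> v /mem_ballots; rewrite -eq_sw => /mapP[w /mem_paths wP ->].
by exists w.
Qed.
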